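(* Let $\mathbf U=(D,\boldsymbol m,E)^\top\in G_u$ and let $p(\mathbf U)$ be the unique positive solution of $\Phi_{\mathbf U}(p)=0$. Set $p_L^{(0)}=0$ and $$p_R^{(0)}=(\Gamma-1)\Big(E-D\sqrt{1-\tfrac{\|\boldsymbol m\|^2}{E^2}}\Big).$$ Then $p(\mathbf U)\in\big(p_L^{(0)},p_R^{(0)}\big)$. For $n\ge 0$ let $p^{(n)}=\frac12\big(p_L^{(n)}+p_R^{(n)}\big)$, where for $n=1,2,\dots$ the bisection method proceeds by $$\big(p_L^{(n)},p_R^{(n)}\big)=\begin{cases}\big(p_L^{(n-1)},p^{(n-1)}\big), & \text{if }\Phi_{\mathbf U}(p^{(n-1)})>0,\\ \big(p^{(n-1)},p_R^{(n-1)}\big), & \text{if }\Phi_{\mathbf U}(p^{(n-1)})\le 0.\end{cases}$$ Then $p(\mathbf U)\in\big(p_L^{(n)},p_R^{(n)}\big)$ and $$\big|p^{(n)}-p(\mathbf U)\big|\le\frac{p_R^{(0)}}{2^{n+1}},$$ which indicates the convergence $\lim_{n\to+\infty}p^{(n)}=p(\mathbf U)$.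
   Context: Fix $\Gamma\in(1,2]$; $\|\cdot\|$ is the Euclidean norm on $\mathbb R^2$. For $\mathbf U=(D,\boldsymbol m,E)^\top\in\mathbb R^4$ with $\boldsymbol m\in\mathbb R^2$, $$\Phi_{\mathbf U}(p)=\frac{p}{\Gamma-1}-E+\frac{\|\boldsymbol m\|^2}{E+p}+D\sqrt{1-\frac{\|\boldsymbol m\|^2}{(E+p)^2}},\qquad p\in[0,\infty).$$ $p(\mathbf U)$ denotes the solution in $[0,\infty)$ of $\Phi_{\mathbf U}(p)=0$, $\boldsymbol v(\mathbf U)=\boldsymbol m/(E+p(\mathbf U))$, $\rho(\mathbf U)=D\sqrt{1-\|\boldsymbol v(\mathbf U)\|^2}$, and $G_u=\{\mathbf U\in\mathbb R^4:\rho(\mathbf U)>0,\ p(\mathbf U)>0,\ \|\boldsymbol v(\mathbf U)\|<1\}$. It is known that $G_u=\{\mathbf U:D>0,\ E>\sqrt{D^2+\|\boldsymbol m\|^2}\}$, and that for $\mathbf U\in G_u$ the function $\Phi_{\mathbf U}$ is strictly increasing on $[0,\infty)$ and has a unique positive root.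
   Formalization: The open intervals fail if m = 0 (then p(U) = p_R^(n) for all n) or if an earlier midpoint is exactly the root (then p(U) = p_L^(n)); strictness on the right is claimed for m ≠ 0, on the left if no p^(k), k < n, is a root, and closed bounds always. *)

(* Defs.v *)
From HB Require Import structures.
From mathcomp Require Import all_boot all_order all_algebra.
From mathcomp Require Import all_classical all_reals all_analysis.
Set Implicit Arguments.
Unset Strict Implicit.
Unset Printing Implicit Defensive.
Import Order.TTheory GRing.Theory Num.Theory.
Import numFieldNormedType.Exports.
Local Open Scope classical_set_scope.
Local Open Scope ring_scope.

(* The library norm on row vectors is the max norm, hence this definition. *)
Definition enorm (R : realType) (x : 'rV[R]_2) : R :=
  Num.sqrt (\sum_(i < 2) x 0 i ^+ 2).

Record state (R : realType) := State {
  sD : R;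
  sm : 'rV[R]_2;
  sE : R }.

(* Total in [p]: a division by 0 and the square root of a negative number
   are both 0; neither occurs for [p >= 0] and [U] in [Gu]. *)
Definition Phi (R : realType) (Gam : R) (U : state R) (p : R) : R :=
  p / (Gam - 1) - sE U + enorm (sm U) ^+ 2 / (sE U + p)
  + sD U * Num.sqrt (1 - enorm (sm U) ^+ 2 / (sE U + p) ^+ 2).

(* The default value 0, taken when [Phi Gam U] has no root in [0, +oo),
   leaves such a [U] outside [Gu]. *)
Definition pressure (R : realType) (Gam : R) (U : state R) : R :=
  xget 0 [set p : R | 0 <= p /\ Phi Gam U p = 0].

Definition velocity (R : realType) (Gam : R) (U : state R) : 'rV[R]_2 :=
  (sE U + pressure Gam U)^-1 *: sm U.

Definition density (R : realType) (Gam : R) (U : state R) : R :=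
  sD U * Num.sqrt (1 - enorm (velocity Gam U) ^+ 2).

Definition Gu (R : realType) (Gam : R) : set (state R) :=
  [set U | [/\ 0 < density Gam U, 0 < pressure Gam U
             & enorm (velocity Gam U) < 1]].

Definition pR0 (R : realType) (Gam : R) (U : state R) : R :=
  (Gam - 1) * (sE U - sD U * Num.sqrt (1 - enorm (sm U) ^+ 2 / sE U ^+ 2)).

Definition midpoint (R : realType) (I : R * R) : R := (I.1 + I.2) / 2.

Fixpoint bisect (R : realType) (Gam : R) (U : state R) (n : nat) : R * R :=
  if n is k.+1 then
    let I := bisect Gam U k in
    if 0 < Phi Gam U (midpoint I) then (I.1, midpoint I) else (midpoint I, I.2)
  else (0, pR0 Gam U).

Definition pL (R : realType) (Gam : R) (U : state R) (n : nat) : R :=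
  (bisect Gam U n).1.

Definition pR (R : realType) (Gam : R) (U : state R) (n : nat) : R :=
  (bisect Gam U n).2.

Definition pmid (R : realType) (Gam : R) (U : state R) (n : nat) : R :=
  midpoint (bisect Gam U n).

(* If an iterate is exactly the root, the bisection takes it as left endpoint
   from then on, and the root is no longer interior to the intervals. *)
Definition no_hit_before (R : realType) (Gam : R) (U : state R) (n : nat)
    : Prop :=
  forall k : nat, (k < n)%N -> Phi Gam U (pmid Gam U k) <> 0.

(* Main.v *)
Require Import Defs.
From HB Require Import structures.
From mathcomp Require Import all_boot all_order all_algebra.
From mathcomp Require Import all_classical all_reals all_analysis.
From mathcomp Require Import ring lra.
Set Implicit Arguments.
Unset Strict Implicit.
Unset Printing Implicit Defensive.
Import Order.TTheory GRing.Theory Num.Theory.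
Import numFieldNormedType.Exports.
Local Open Scope classical_set_scope.
Local Open Scope ring_scope.

(** Everything follows from two facts about an admissible state
    U = (D, m, E).

    First, admissibility, which is a statement about the root p of [Phi],
    forces the explicit inequalities D > 0, E > 0 and D^2 + |m|^2 < E^2
    ([Gu_cone]).  This is algebra with the equation Phi(p) = 0, written in
    terms of the total energy s = E + p and of w = sqrt (1 - |v|^2), once s is
    known to be positive ([Gu_total_energy_gt0]).

    Second, these inequalities and Gam <= 2 make [Phi] strictly increasing on
    [0, +oo) ([Phi_increasing]): the slope 1 / (Gam - 1) >= 1 of the linear term
    outweighs the decrease of |m|^2 / (E + p), and the square root term is
    nondecreasing.  Therefore the sign of [Phi] at any q >= 0 tells on which
    side of the root q lies ([Phi_le0], [Phi_lt0]).

    Evaluating at the right end of the initial bracket gives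
    Phi(pR0) >= |m|^2 / (E + pR0) ([Phi_pR0]), so the root is at most [pR0], and
    strictly below it when m is nonzero.  If m = 0, then Phi(pR0) = 0 and the
    root is [pR0] itself.  From there each bisection step keeps the root in the
    interval ([bisect_bracket]) and halves its length ([bisect_width]), which
    yields the error bound and the convergence. *)

(** * The Euclidean norm *)

Lemma enorm_ge0 (R : realType) (x : 'rV[R]_2) : 0 <= enorm x.
Proof. exact: sqrtr_ge0. Qed.

Lemma enorm_sqr (R : realType) (x : 'rV[R]_2) :
  enorm x ^+ 2 = \sum_(i < 2) x 0 i ^+ 2.
Proof. by rewrite /enorm sqr_sqrtr// sumr_ge0// => i _; exact: sqr_ge0. Qed.

Lemma enormZ_sqr (R : realType) (a : R) (x : 'rV[R]_2) :
  enorm (a *: x) ^+ 2 = a ^+ 2 * enorm x ^+ 2.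
Proof.
by rewrite !enorm_sqr mulr_sumr; apply: eq_bigr => i _; rewrite mxE exprMn.
Qed.

Lemma enorm_sqr_gt0 (R : realType) (x : 'rV[R]_2) :
  x != 0 -> 0 < enorm x ^+ 2.
Proof.
apply: contra_neqT; rewrite -leNgt enorm_sqr => x_le0.
have x2_ge0 (i : 'I_2) : true -> 0 <= x 0 i ^+ 2 by move=> _; exact: sqr_ge0.
have /eqP : \sum_(i < 2) x 0 i ^+ 2 == 0 by rewrite eq_le x_le0 sumr_ge0.
move=> /(psumr_eq0P x2_ge0) x0.
by apply/rowP => i; apply/eqP; rewrite mxE -sqrf_eq0 x0.
Qed.

(** * Admissible states lie in the cone *)

(** A positive value of [pressure] cannot be the default value 0 of the choice
    operator, so it is a root. *)
Lemma Phi_pressure (R : realType) (Gam : R) (U : state R) :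
  0 < pressure Gam U -> Phi Gam U (pressure Gam U) = 0.
Proof.
by rewrite /pressure; case: xgetP => [p _ [] //|_]; rewrite ltxx.
Qed.

(** With s = E + p, the equation Phi(p) = 0 reads
    p / (Gam - 1) + p - s + |m|^2 / s + D w = 0, where D w is the density.
    If s < 0, then |m|^2 / s - s = - s (1 - |v|^2) > 0 and every term is
    positive; if s = 0, the conventions 1 / 0 = 0 and v = 0 leave only
    positive terms as well.  Either way the sum cannot vanish. *)
Lemma Gu_total_energy_gt0 (R : realType) (Gam : R) (U : state R) :
  1 < Gam -> Gu Gam U -> 0 < sE U + pressure Gam U.
Proof.
move=> Gam1 [rho_gt0 p_gt0 v_lt1]; have := Phi_pressure p_gt0.
move: rho_gt0 v_lt1 p_gt0; rewrite /density /Phi.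
set p := pressure Gam U; set w := Num.sqrt _ => rho_gt0 v_lt1 p_gt0 Phi0.
rewrite ltNge; apply/negP => s_le0.
have v2_lt1 : enorm (velocity Gam U) ^+ 2 < 1 by rewrite expr_lt1 ?enorm_ge0.
have v2E : enorm (velocity Gam U) ^+ 2 = enorm (sm U) ^+ 2 / (sE U + p) ^+ 2.
  by rewrite enormZ_sqr exprVn mulrC.
have pG_gt0 : 0 < p / (Gam - 1) by rewrite divr_gt0// subr_gt0.
have [s0|s_neq0] := eqVneq (sE U + p) 0.
  move: Phi0; rewrite -v2E -/w s0 invr0 mulr0; lra.
have flux : enorm (sm U) ^+ 2 / (sE U + p)
            = enorm (velocity Gam U) ^+ 2 * (sE U + p) by rewrite v2E; field.
move: Phi0; rewrite -v2E -/w flux; nra.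
Qed.

(** The physical set lies in the cone D > 0, E > sqrt (D^2 + |m|^2).
    Put s = E + p and w = sqrt (1 - |v|^2), so that |m|^2 = (1 - w^2) s^2, and
    q = s w^2 - D w.  Then Phi(p) = 0 says p + p / (Gam - 1) = q, hence
    2 p <= q because Gam <= 2, and E = s - p >= s - q / 2 > 0.  Positivity of q
    means D < s w, and
    (s - q / 2)^2 - D^2 - |m|^2 = D (s w - D) + q^2 / 4 > 0. *)
Lemma Gu_cone (R : realType) (Gam : R) (U : state R) :
  1 < Gam <= 2 -> Gu Gam U ->
  [/\ 0 < sD U, 0 < sE U & sD U ^+ 2 + enorm (sm U) ^+ 2 < sE U ^+ 2].
Proof.
move=> /andP[Gam1 Gam2] UGu; have s_gt0 := Gu_total_energy_gt0 Gam1 UGu.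
case: UGu => rho_gt0 p_gt0 v_lt1; have := Phi_pressure p_gt0.
move: rho_gt0 v_lt1; rewrite /density /Phi.
have v2E : enorm (velocity Gam U) ^+ 2
           = enorm (sm U) ^+ 2 / (sE U + pressure Gam U) ^+ 2.
  by rewrite enormZ_sqr exprVn mulrC.
rewrite -v2E; move: v2E p_gt0 s_gt0.
set p := pressure Gam U; set V := enorm (velocity Gam U).
set M := enorm (sm U) ^+ 2; set D := sD U; set E := sE U.
set w := Num.sqrt _ => V2E p_gt0 s_gt0 rho_gt0 V_lt1 Phi0.
have V_ge0 : 0 <= V by exact: enorm_ge0.
have w2 : w ^+ 2 = 1 - V ^+ 2 by rewrite sqr_sqrtr// subr_ge0 expr_le1// ltW.
have w_ge0 : 0 <= w by exact: sqrtr_ge0.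
have D_gt0 : 0 < D by nra.
have w_gt0 : 0 < w by nra.
have w_le1 : w <= 1 by nra.
have ME : M = (1 - w ^+ 2) * (E + p) ^+ 2.
  have -> : 1 - w ^+ 2 = M / (E + p) ^+ 2 by rewrite w2 V2E; ring.
  by field; rewrite gt_eqF.
(* This is where Gam <= 2 enters: 1 / (Gam - 1) >= 1. *)
have pG_ge : p <= p / (Gam - 1).
  by rewrite ler_pdivlMr ?subr_gt0//; nra.
have := Phi0.
have -> : M / (E + p) = (1 - w ^+ 2) * (E + p).
  by rewrite ME; field; rewrite gt_eqF.
set s := E + p in ME s_gt0 *.
have EE : E = s - p by rewrite /s; ring.
rewrite EE ME => {}Phi0.
set q := s * w ^+ 2 - D * w.
have q_ge : 2 * p <= q by rewrite /q; lra.
have sw_gt : D < s * w.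
  by rewrite -(ltr_pM2r w_gt0); rewrite /q in q_ge; nra.
have q_le : q <= s by rewrite /q; nra.
split => //; first lra.
have : (s - q / 2) ^+ 2 <= (s - p) ^+ 2.
  by rewrite ler_pXn2r ?nnegrE//; lra.
apply: lt_le_trans.
have -> : (s - q / 2) ^+ 2 = D ^+ 2 + (1 - w ^+ 2) * s ^+ 2
                             + (D * (s * w - D) + q ^+ 2 / 4).
  by rewrite /q; field.
by rewrite ltrDl ltr_wpDr// ?divr_ge0 ?sqr_ge0// mulr_gt0// subr_gt0.
Qed.

(** * Monotonicity of the pressure function *)

(** The inverse Lorentz factor grows with the total energy s, the momentum
    being fixed. *)
Lemma lorentz_le (R : realType) (M s t : R) :
  0 <= M -> 0 < s -> s <= t ->
  Num.sqrt (1 - M / s ^+ 2) <= Num.sqrt (1 - M / t ^+ 2).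
Proof.
move=> M_ge0 s_gt0 st; have t_gt0 := lt_le_trans s_gt0 st.
apply: ler_wsqrtr; rewrite lerD2l lerN2 ler_wpM2l//.
by rewrite lef_pV2 ?posrE ?exprn_gt0// ler_pXn2r ?nnegrE// ltW.
Qed.

(** Raising the pressure by q - p raises the first term by at least q - p,
    since Gam <= 2, and does not lower the last one.  It lowers |m|^2 / (E + p)
    by |m|^2 (q - p) / ((E + p) (E + q)), which is less than q - p because
    |m| < E. *)
Lemma Phi_increasing (R : realType) (Gam : R) (U : state R) (p q : R) :
  1 < Gam <= 2 -> 0 <= sD U -> 0 < sE U -> enorm (sm U) ^+ 2 < sE U ^+ 2 ->
  0 <= p -> p < q -> Phi Gam U p < Phi Gam U q.
Proof.
move=> /andP[Gam1 Gam2] D_ge0 E_gt0 ME p_ge0 pq; rewrite /Phi.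
set D := sD U in D_ge0 *; set E := sE U in E_gt0 ME *.
set M := enorm (sm U) ^+ 2 in ME *.
have M_ge0 : 0 <= M by exact: sqr_ge0.
have s_gt0 : 0 < E + p by lra.
have t_gt0 : 0 < E + q by lra.
have := lorentz_le M_ge0 s_gt0 (_ : E + p <= E + q); rewrite lerD2l (ltW pq).
move=> /(_ isT) /(ler_wpM2l D_ge0) w_le.
have pG : q - p <= q / (Gam - 1) - p / (Gam - 1).
  by rewrite -mulrBl ler_pdivlMr ?subr_gt0//; nra.
have flux : M / (E + p) - M / (E + q) < q - p.
  have -> : M / (E + p) - M / (E + q)
            = M * (q - p) / ((E + p) * (E + q)).
    by field; rewrite !gt_eqF.
  rewrite ltr_pdivrMr ?mulr_gt0// mulrC ltr_pM2l ?subr_gt0//; nra.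
lra.
Qed.

Lemma Phi_mono (R : realType) (Gam : R) (U : state R) :
  1 < Gam <= 2 -> Gu Gam U ->
  {in >= 0 &, {mono Phi Gam U : p q / p <= q}}.
Proof.
move=> hGam UGu; have [D_gt0 E_gt0 cone] := Gu_cone hGam UGu.
apply: le_mono_in => p q p_ge0 _; apply: Phi_increasing => //; first exact: ltW.
by apply: le_lt_trans cone; rewrite lerDr sqr_ge0.
Qed.

(** The sign test of the bisection locates the root: since [Phi] is strictly
    increasing and vanishes at the pressure, comparing its value with 0 amounts
    to comparing the argument with the pressure. *)
Lemma Phi_le0 (R : realType) (Gam : R) (U : state R) (q : R) :
  1 < Gam <= 2 -> Gu Gam U -> 0 <= q ->
  (Phi Gam U q <= 0) = (q <= pressure Gam U).
Proof.
move=> hGam UGu q_ge0; have [_ p_gt0 _] := UGu.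
rewrite -[leRHS](Phi_pressure p_gt0) (Phi_mono hGam UGu)//.
exact: ltW.
Qed.

Lemma Phi_lt0 (R : realType) (Gam : R) (U : state R) (q : R) :
  1 < Gam <= 2 -> Gu Gam U -> 0 <= q ->
  (Phi Gam U q < 0) = (q < pressure Gam U).
Proof.
move=> hGam UGu q_ge0; have [_ p_gt0 _] := UGu.
rewrite -[ltRHS](Phi_pressure p_gt0) (leW_mono_in (Phi_mono hGam UGu))//.
exact: ltW.
Qed.

(** * The initial bracket *)

(** The cone condition gives D < E, and the square root is at most 1. *)
Lemma pR0_gt0 (R : realType) (Gam : R) (U : state R) :
  1 < Gam <= 2 -> Gu Gam U -> 0 < pR0 Gam U.
Proof.
move=> hGam UGu; have [D_gt0 E_gt0 cone] := Gu_cone hGam UGu.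
have /andP[Gam1 _] := hGam.
rewrite /pR0 mulr_gt0 ?subr_gt0//.
have M_ge0 := sqr_ge0 (enorm (sm U)).
have DE : sD U < sE U by rewrite -(ltr_pXn2r (n := 2)) ?nnegrE ?ltW//; lra.
apply: le_lt_trans DE; rewrite ler_piMr ?(ltW D_gt0)//.
by rewrite -[leRHS]sqrtr1 ler_wsqrtr// lerBlDr lerDl divr_ge0// ?sqr_ge0.
Qed.

(** Write w(p) for the square root in [Phi].  At [pR0] the first two terms of
    [Phi] add up to - D w(0), and w(pR0) >= w(0), so only |m|^2 / (E + pR0) has to be kept.  This bound is
    positive exactly when m is nonzero, which decides whether the root is
    strictly below [pR0]. *)
Lemma Phi_pR0 (R : realType) (Gam : R) (U : state R) :
  1 < Gam <= 2 -> Gu Gam U ->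
  enorm (sm U) ^+ 2 / (sE U + pR0 Gam U) <= Phi Gam U (pR0 Gam U).
Proof.
move=> hGam UGu; have [D_gt0 E_gt0 _] := Gu_cone hGam UGu.
have p_gt0 := pR0_gt0 hGam UGu; have /andP[Gam1 _] := hGam.
have := lorentz_le (sqr_ge0 (enorm (sm U))) E_gt0
  (_ : sE U <= sE U + pR0 Gam U); rewrite lerDl (ltW p_gt0).
move=> /(_ isT) /(ler_wpM2l (ltW D_gt0)) w_le; rewrite /Phi.
have -> : pR0 Gam U / (Gam - 1)
    = sE U - sD U * Num.sqrt (1 - enorm (sm U) ^+ 2 / sE U ^+ 2).
  by rewrite /pR0 mulrAC divff ?mul1r// gt_eqF ?subr_gt0.
lra.
Qed.

Lemma pressure_le_pR0 (R : realType) (Gam : R) (U : state R) :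
  1 < Gam <= 2 -> Gu Gam U -> pressure Gam U <= pR0 Gam U.
Proof.
move=> hGam UGu; have [_ E_gt0 _] := Gu_cone hGam UGu.
have r_gt0 := pR0_gt0 hGam UGu.
rewrite leNgt -(Phi_lt0 hGam UGu (ltW r_gt0)) -leNgt.
apply: le_trans (Phi_pR0 hGam UGu).
by rewrite divr_ge0 ?sqr_ge0// ltW ?addr_gt0.
Qed.

Lemma pressure_lt_pR0 (R : realType) (Gam : R) (U : state R) :
  1 < Gam <= 2 -> Gu Gam U -> sm U != 0 -> pressure Gam U < pR0 Gam U.
Proof.
move=> hGam UGu m_neq0; have [_ E_gt0 _] := Gu_cone hGam UGu.
have r_gt0 := pR0_gt0 hGam UGu.
rewrite ltNge -(Phi_le0 hGam UGu (ltW r_gt0)) -ltNge.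
apply: lt_le_trans (Phi_pR0 hGam UGu).
by rewrite divr_gt0 ?enorm_sqr_gt0 ?addr_gt0.
Qed.

(** * The bisection *)

Lemma bisect_width (R : realType) (Gam : R) (U : state R) (n : nat) :
  pR Gam U n - pL Gam U n = pR0 Gam U / 2 ^+ n.
Proof.
rewrite /pR /pL; elim: n => [|n IHn] /=; first by rewrite subr0 expr0 divr1.
have -> : pR0 Gam U / 2 ^+ n.+1 = pR0 Gam U / 2 ^+ n / 2.
  by rewrite exprSr invfM mulrA.
by rewrite -IHn /midpoint; case: ifP => _ /=; field.
Qed.

Lemma bisect_bracket (R : realType) (Gam : R) (U : state R) (n : nat) :
  1 < Gam <= 2 -> Gu Gam U ->
  [/\ 0 <= pL Gam U n, pL Gam U n <= pressure Gam U
    & pressure Gam U <= pR Gam U n].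
Proof.
move=> hGam UGu; have [_ p_gt0 _] := UGu.
rewrite /pR /pL; elim: n => [|n [L_ge0 Lp p_le]] /=.
  by split=> //; [exact: ltW|exact: pressure_le_pR0].
have mid_ge0 : 0 <= midpoint (bisect Gam U n) by rewrite /midpoint; lra.
by rewrite ltNge Phi_le0//; case: (leP (midpoint _)) => /= [|/ltW].
Qed.

(** The left endpoint is 0 or an earlier midpoint at which [Phi] is not
    positive; it equals the root only if that midpoint was a root. *)
Lemma pL_lt_pressure (R : realType) (Gam : R) (U : state R) (n : nat) :
  1 < Gam <= 2 -> Gu Gam U -> no_hit_before Gam U n ->
  pL Gam U n < pressure Gam U.
Proof.
move=> hGam UGu; have [_ p_gt0 _] := UGu; elim: n => [//|n IHn] nohit.
have L_lt : pL Gam U n < pressure Gam U.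
  by apply: IHn => k kn; apply: nohit; exact: ltnW.
have [L_ge0 _ p_le] := bisect_bracket n hGam UGu.
have mid_ge0 : 0 <= midpoint (bisect Gam U n).
  by rewrite /midpoint -/(pL _ _ _) -/(pR _ _ _); lra.
rewrite /pL /= (ltNge 0) Phi_le0//; case: (leP (midpoint _)) => //= mid_le.
rewrite lt_neqAle mid_le andbT; apply/eqP => midE.
by apply: (nohit n); rewrite // /pmid midE Phi_pressure.
Qed.

(** The right endpoint is [pR0], where nonzero momentum gives strictness, or
    an earlier midpoint at which [Phi] is positive. *)
Lemma pressure_lt_pR (R : realType) (Gam : R) (U : state R) (n : nat) :
  1 < Gam <= 2 -> Gu Gam U -> sm U != 0 -> pressure Gam U < pR Gam U n.
Proof.
move=> hGam UGu m_neq0; elim: n => [|n IHn]; first exact: pressure_lt_pR0.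
have [L_ge0 Lp _] := bisect_bracket n hGam UGu.
have mid_ge0 : 0 <= midpoint (bisect Gam U n).
  by rewrite /midpoint -/(pL _ _ _) -/(pR _ _ _); lra.
by rewrite /pR /= (ltNge 0) Phi_le0//; case: (leP (midpoint _)).
Qed.

(** The root and the midpoint lie in one interval of length pR0 / 2^n, hence
    they are at most half of this length apart. *)
Lemma pmid_error (R : realType) (Gam : R) (U : state R) (n : nat) :
  1 < Gam <= 2 -> Gu Gam U ->
  `|pmid Gam U n - pressure Gam U| <= pR0 Gam U / 2 ^+ n.+1.
Proof.
move=> hGam UGu; have [_ Lp p_le] := bisect_bracket n hGam UGu.
have -> : pR0 Gam U / 2 ^+ n.+1 = (pR Gam U n - pL Gam U n) / 2.
  by rewrite bisect_width exprSr invfM mulrA.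
rewrite /pmid /midpoint -/(pL _ _ _) -/(pR _ _ _) ler_norml; lra.
Qed.

Lemma cvg_pmid (R : realType) (Gam : R) (U : state R) :
  1 < Gam <= 2 -> Gu Gam U -> pmid Gam U n @[n --> \oo] --> pressure Gam U.
Proof.
move=> hGam UGu; apply/cvgrPdistC_le => eps eps_gt0.
have bound_cvg : pR0 Gam U / 2 ^+ n.+1 @[n --> \oo] --> (0 : R).
  have -> : (fun n => pR0 Gam U / 2 ^+ n.+1) = geometric (pR0 Gam U / 2) 2^-1.
    by apply/funext => n; rewrite /geometric /= exprS exprVn invfM mulrA.
  by apply: cvg_geometric; rewrite gtr0_norm ?invf_lt1 ?invr_gt0 ?ltr1n.
near=> n; apply: le_trans (pmid_error n hGam UGu) _.
by near: n; exact: (cvgr_le _ bound_cvg).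
Unshelve. all: by end_near.
Qed.

Theorem mainTheorem3 (R : realType) (Gam : R) (hGam : 1 < Gam <= 2)
    (U : state R) (hU : Gu Gam U) :
  [/\ pressure Gam U \in `]0, pR0 Gam U]
        /\ (sm U != 0 -> pressure Gam U \in `]0, pR0 Gam U[),
      forall n : nat,
        [/\ pressure Gam U \in `[pL Gam U n, pR Gam U n],
            no_hit_before Gam U n ->
              pressure Gam U \in `]pL Gam U n, pR Gam U n],
            sm U != 0 -> pressure Gam U \in `[pL Gam U n, pR Gam U n[
          & sm U != 0 -> no_hit_before Gam U n ->
              pressure Gam U \in `]pL Gam U n, pR Gam U n[ ],
      forall n : nat,
        `|pmid Gam U n - pressure Gam U| <= pR0 Gam U / 2 ^+ n.+1
    & pmid Gam U n @[n --> \oo] --> pressure Gam U].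
Proof.
have [_ p_gt0 _] := hU; split.
- split=> [|m_neq0]; rewrite in_itv /= p_gt0 /=; first exact: pressure_le_pR0.
  exact: pressure_lt_pR0.
- move=> n; have [_ Lp p_le] := bisect_bracket n hGam hU.
  split=> [|nohit|m_neq0|m_neq0 nohit]; rewrite in_itv /= ?Lp ?p_le//.
  + by rewrite andbT pL_lt_pressure.
  + exact: pressure_lt_pR.
  + by rewrite pL_lt_pressure// pressure_lt_pR.
- by move=> n; exact: pmid_error.
- exact: cvg_pmid.
Qed.
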